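(* Let $R$ be a commutative ring, let $q$ be an indeterminate, and let $S$ be the antipode of $\mathtt{QSym}^{(q)}$. Then for every $n\geq0$ and every composition $\alpha\vDash n$ we have $$S(F_{\alpha}^{(q)})=(-1)^{n}q^{\operatorname{inv}(\alpha^{t})}\widetilde{F}_{\alpha^{t}}^{(q)}.$$
   Context: Compositions. A composition $\alpha\vDash n$ of an integer $n\geq0$ is a finite sequence $(\alpha_{1},\ldots,\alpha_{\ell})$ of positive integers summing to $n$; $\ell(\alpha)=\ell$ is its length, and $\emptyset$ is the only composition of $0$. Put $\mathbb{N}_{n-1}=\{1,\ldots,n-1\}$. For $n\geq1$, $\operatorname{comp}_{n}$ is the bijection from subsets of $\mathbb{N}_{n-1}$ to compositions of $n$ that takes $T=\{t_{1}<\cdots<t_{\ell-1}\}$ to the composition of length $\ell$ whose $j$th entry is $t_{j}-t_{j-1}$, where $t_{0}=0$ and $t_{\ell}=n$. For compositions $\alpha,\beta$ of the same $n$, $\beta\preceq\alpha$ means that $\beta$ refines $\alpha$, i.e., $\beta$ is the concatenation, in order, of compositions of $\alpha_{1},\ldots,\alpha_{\ell}$. If $\alpha=\operatorname{comp}_{n}T$ then the transpose is $\alpha^{t}=\operatorname{comp}_{n}\{n-t\;|\;t\in\mathbb{N}_{n-1}\setminus T\}$; also $\emptyset^{t}=\emptyset$. The inversion number is $\operatorname{inv}(\alpha)=\sum_{1\leq i<j\leq\ell}\alpha_{i}\alpha_{j}$; it satisfies $\operatorname{inv}(\beta)\geq\operatorname{inv}(\alpha)$ when $\beta\preceq\alpha$.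 The algebra $\mathtt{QSym}^{(q)}$. Consider power series over $R[q]$ in variables $x_{1},x_{2},\ldots$ subject to $x_{j}x_{i}=qx_{i}x_{j}$ for $i<j$. For a composition $\alpha$ of length $\ell$ set $M_{\alpha}^{(q)}=\sum_{i_{1}<\cdots<i_{\ell}}x_{i_{1}}^{\alpha_{1}}\cdots x_{i_{\ell}}^{\alpha_{\ell}}$. Then $\mathtt{QSym}^{(q)}$ is the free $R[q]$-module with basis $\{M_{\alpha}^{(q)}\}_{\alpha}$, $\alpha$ running over all compositions. It is closed under the product: $M_{\emptyset}^{(q)}=1$, and for $\alpha=(\alpha_{1},\bar{\alpha})$ with $\bar{\alpha}\vDash m$ and $\beta=(\beta_{1},\bar{\beta})$, $$M_{\alpha}^{(q)}M_{\beta}^{(q)}=l_{\alpha_{1}}(M_{\bar{\alpha}}^{(q)}M_{\beta}^{(q)})+q^{\beta_{1}(\alpha_{1}+m)}l_{\beta_{1}}(M_{\alpha}^{(q)}M_{\bar{\beta}}^{(q)})+q^{\beta_{1}m}l_{\alpha_{1}+\beta_{1}}(M_{\bar{\alpha}}^{(q)}M_{\bar{\beta}}^{(q)}),$$ where $l_{a}$ is the $R[q]$-linear map with $l_{a}M_{\gamma}^{(q)}=M_{(a,\gamma)}^{(q)}$. The co-multiplication is $\Delta(M_{\alpha}^{(q)})=\sum_{k=0}^{\ell(\alpha)}M_{(\alpha_{1},\ldots,\alpha_{k})}^{(q)}\otimes M_{(\alpha_{k+1},\ldots,\alpha_{\ell(\alpha)})}^{(q)}$ (tensor over $R[q]$),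 and the co-unit $\varepsilon$ sends $M_{\emptyset}^{(q)}$ to $1$ and the other $M_{\alpha}^{(q)}$ to $0$. With $m$ the multiplication and $\eta$ the unit, this is an algebra and a co-algebra (a ''$q$-Hopf algebra'', not a Hopf algebra, since $\Delta$ is not multiplicative), and its antipode is the unique $R[q]$-linear map $S$ with $m\circ(S\otimes\operatorname{Id})\circ\Delta=\eta\circ\varepsilon=m\circ(\operatorname{Id}\otimes S)\circ\Delta$, which exists. Set $F_{\alpha}^{(q)}=\sum_{\beta\preceq\alpha}M_{\beta}^{(q)}$ and $\widetilde{F}_{\alpha}^{(q)}=\sum_{\beta\preceq\alpha}q^{\operatorname{inv}(\beta)-\operatorname{inv}(\alpha)}M_{\beta}^{(q)}$. *)

(* Defs.v *)
From HB Require Import structures.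
From mathcomp Require Import all_boot all_algebra.
From mathcomp.multinomials Require Import freeg.

Set Implicit Arguments.
Unset Strict Implicit.
Unset Printing Implicit Defensive.

Import GRing.Theory.
Local Open Scope nat_scope.

Record posnat := PosNat { nat_of_pos :> nat; _ : 0 < nat_of_pos }.
HB.instance Definition _ := [isSub for nat_of_pos].
HB.instance Definition _ := [Choice of posnat by <:].

Lemma posnat_gt0 (a : posnat) : 0 < a. Proof. by case: a. Qed.

Definition posnat_add (a b : posnat) : posnat :=
  @PosNat (a + b) (ltn_addr b (posnat_gt0 a)).

Notation composition := (seq posnat).

Definition weight (alpha : composition) : nat :=
  \sum_(a <- alpha) nat_of_pos a.

Definition comp_inv (alpha : composition) : nat :=
  \sum_(i < size alpha) \sum_(j < size alpha | i < j)
    nat_of_pos (tnth (in_tuple alpha) i) * nat_of_pos (tnth (in_tuple alpha) j).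

(** A subset [T] of [{1, ..., n-1}] is encoded as [T : {set 'I_n.-1}], where
    [i : 'I_n.-1] stands for the integer [i.+1].  Under this encoding
    [t |-> n - t] is [rev_ord], as [n - i.+1 = (rev_ord i).+1].  The sequence of differences below is positive
    (so that [pmap insub] discards nothing, see [compn_parts]) unless [n = 0],
    in which case it is [[:: 0]] and [@compn 0 T] is the empty composition. *)
Definition compn (n : nat) (T : {set 'I_n.-1}) : composition :=
  pmap insub
    (pairmap (fun s t => t - s) 0 (rcons [seq (nat_of_ord i).+1 | i <- enum T] n)).

(** The inverse of [@compn n] on the compositions of [n] (see [descentsK] and
    [compnK]): the set of the proper partial sums. *)
Definition descents (n : nat) (alpha : composition) : {set 'I_n.-1} :=
  [set i : 'I_n.-1 | i.+1 \in scanl addn 0 [seq nat_of_pos a | a <- alpha]].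

Definition tr_comp (alpha : composition) : composition :=
  let n := weight alpha in compn [set rev_ord i | i in ~: descents n alpha].

Definition compositions (n : nat) : seq composition :=
  [seq compn T | T : {set 'I_n.-1}].

(** Specified by [refinesP]. *)
Fixpoint refines (beta alpha : composition) : bool :=
  if alpha is a :: alpha' then
    has (fun k => (weight (take k beta) == a) && refines (drop k beta) alpha')
        (iota 0 (size beta).+1)
  else beta == [::].

Lemma weight_nil : weight [::] = 0.
Proof. by rewrite /weight big_nil. Qed.

Lemma weight_cons a alpha : weight (a :: alpha) = a + weight alpha.
Proof. by rewrite /weight big_cons. Qed.

Lemma weight_cat alpha beta : weight (alpha ++ beta) = weight alpha + weight beta.
Proof. by rewrite /weight big_cat. Qed.

Lemma weightE alpha : weight alpha = sumn [seq nat_of_pos a | a <- alpha].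
Proof. by rewrite sumnE big_map. Qed.

Lemma refinesP beta alpha :
  reflect (exists2 bs : seq composition, beta = flatten bs
             & [seq weight b | b <- bs] = [seq nat_of_pos a | a <- alpha])
          (refines beta alpha).
Proof.
elim: alpha beta => [|a alpha IH] beta.
  apply: (iffP eqP) => [->|[[|b bs] -> //=]]; by exists [::].
have -> : refines beta (a :: alpha) =
    has (fun k => (weight (take k beta) == a) && refines (drop k beta) alpha)
        (iota 0 (size beta).+1) by [].
apply: (iffP hasP) => [[k _ /andP[/eqP wk /IH [bs E W]]]|[[//|b bs] -> [wb W]]].
  by exists (take k beta :: bs); rewrite /= ?wk ?W // -E cat_take_drop.
exists (size b); first by rewrite mem_iota add0n ltnS size_cat leq_addr.
rewrite take_size_cat // drop_size_cat // wb eqxx /=; apply/IH; by exists bs.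
Qed.

Section Comp.

Variables (n : nat).
Implicit Types T : {set 'I_n.-1}.

Let ts T := [seq (nat_of_ord i).+1 | i <- enum T].

Let ts_path T : 0 < n -> path ltn 0 (rcons (ts T) n).
Proof.
move=> n_gt0.
have srt : sorted ltn (ts T).
  rewrite /ts sorted_map.
  have : sorted (relpre (fun i : 'I_n.-1 => nat_of_ord i) ltn) (enum T).
    rewrite -sorted_map; apply: (subseq_sorted ltn_trans (s2 := iota 0 n.-1)).
      rewrite -val_enum_ord; apply: map_subseq; rewrite enumT; exact: filter_subseq.
    exact: iota_ltn_sorted.
  exact: sub_sorted.
have bnd : all (fun t => 0 < t < n) (ts T).
  by apply/allP => t /mapP[i _ ->]; rewrite -ltn_predRL ltn_ord.
rewrite rcons_path; apply/andP; split.
  rewrite path_min_sorted //; apply/allP=> t /(allP bnd) /andP[]; by [].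
case/lastP: (ts T) bnd => [//|s x]; rewrite all_rcons last_rcons => /andP[/andP[]].
by [].
Qed.

Lemma compn_parts T : 0 < n ->
  [seq nat_of_pos a | a <- compn T] =
  pairmap (fun s t => t - s) 0 (rcons [seq (nat_of_ord i).+1 | i <- enum T] n).
Proof.
move=> n_gt0; rewrite /compn -/(ts T).
have aux s x : path ltn x s ->
    [seq nat_of_pos a | a <- pmap insub (pairmap (fun s t => t - s) x s)] =
    pairmap (fun s t => t - s) x s.
  elim: s x => [//|t s IH] x /= /andP[xt pt].
  case: insubP => [u _ uE|]; last by rewrite subn_gt0 xt.
  by rewrite /= IH // -uE.
exact/aux/ts_path.
Qed.

Let compn_scanl T : 0 < n ->
  scanl addn 0 [seq nat_of_pos a | a <- compn T] = rcons (ts T) n.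
Proof.
move=> n_gt0; rewrite compn_parts // -/(ts T).
have aux s x : path ltn x s ->
    scanl addn x (pairmap (fun s t => t - s) x s) = s.
  elim: s x => [//|t s IH] x /= /andP[xt pt].
  by rewrite subnKC ?IH // ltnW.
exact/aux/ts_path.
Qed.

Lemma weight_compn T : weight (compn T) = n.
Proof.
case: (posnP n) => [n0|n_gt0].
  rewrite /compn; have -> : enum T = [::].
    case: (enum T) => // i s; have i_lt : i.+1 < n by rewrite -ltn_predRL ltn_ord.
    by have := ltn_trans (ltn0Sn i) i_lt; rewrite lt0n => /eqP; case.
  by rewrite /= n0 insubF // weight_nil.
rewrite weightE.
have last_scanl x s : last x (scanl addn x s) = x + sumn s.
  by elim: s x => [|y s IH] x /=; rewrite ?addn0 // IH addnA.
have := last_scanl 0 [seq nat_of_pos a | a <- compn T].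
by rewrite compn_scanl // last_rcons.
Qed.

Lemma compnK T : descents n (compn T) = T.
Proof.
apply/setP=> i; rewrite inE.
have i_lt : i.+1 < n by rewrite -ltn_predRL ltn_ord.
have n_gt0 : 0 < n by exact: leq_trans i_lt.
rewrite compn_scanl // mem_rcons inE (ltn_eqF i_lt) /=.
rewrite (mem_map (f := fun i : 'I_n.-1 => (nat_of_ord i).+1)) ?mem_enum //.
by move=> j k /succn_inj /val_inj.
Qed.

Lemma descentsK alpha : weight alpha = n -> compn (descents n alpha) = alpha.
Proof.
move=> wE; case: (posnP n) => [n0|n_gt0].
  have nil (beta : composition) : weight beta = 0 -> beta = [::].
    by case: beta => [//|b beta]; rewrite weight_cons; have := posnat_gt0 b; case: (nat_of_pos b).
  by rewrite [LHS]nil ?[RHS]nil // ?weight_compn ?wE.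
apply: (inj_map val_inj).
have scanl_inj x s1 s2 : scanl addn x s1 = scanl addn x s2 -> s1 = s2.
  elim: s1 s2 x => [|y s1 IH] [|z s2] x //= [/addnI <- /IH ->]; by [].
apply: (@scanl_inj 0); rewrite [LHS]compn_scanl //.
have srtA x : path ltn x (scanl addn x [seq nat_of_pos a | a <- alpha]).
  elim: (alpha) x => [//|a s IH] x /=.
  by rewrite IH andbT -[X in X < _]addn0 ltn_add2l posnat_gt0.
have maxA x t : t \in scanl addn x [seq nat_of_pos a | a <- alpha] ->
    x < t <= x + weight alpha.
  elim: (alpha) x => [//|a s IH] x /=; rewrite weight_cons inE.
  case/orP=> [/eqP->|/IH /andP[lo hi]].
    by rewrite leq_add2l leq_addr -[X in X < _]addn0 ltn_add2l posnat_gt0.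
  by rewrite addnA hi andbT (leq_trans _ lo) // ltnS leq_addr.
apply: (irr_sorted_eq ltn_trans ltnn).
- exact: path_sorted (ts_path _ n_gt0).
- exact: path_sorted (srtA 0).
move=> t; rewrite mem_rcons inE.
have lastA : n \in scanl addn 0 [seq nat_of_pos a | a <- alpha].
  have aux s x : 0 < weight s ->
      x + weight s \in scanl addn x [seq nat_of_pos a | a <- s].
    elim: s x => [|a s IH] x; first by rewrite weight_nil.
    move=> _ /=; rewrite weight_cons addnA inE.
    case: (posnP (weight s)) => [->|s0]; first by rewrite addn0 eqxx.
    by rewrite IH // orbT.
  by have := aux alpha 0; rewrite wE; apply.
apply/idP/idP => [/orP[/eqP-> //|/mapP[i]]|tA].
  by rewrite mem_enum inE => iA ->.
have [//|tn] := eqVneq t n; apply/mapP.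
have /andP[t0 tle] := maxA _ _ tA; rewrite add0n wE in tle.
have tlt : t.-1 < n.-1 by rewrite -ltnS !prednK // ltn_neqAle tn.
exists (Ordinal tlt); last by rewrite /= prednK.
by rewrite mem_enum inE /= prednK.
Qed.

Lemma tr_comp_compn T : tr_comp (compn T) = compn [set rev_ord i | i in ~: T].
Proof.
have aux alpha : weight alpha = n ->
    tr_comp alpha = compn [set rev_ord i | i in ~: descents n alpha] by move=> <-.
by rewrite aux ?weight_compn // compnK.
Qed.

End Comp.

Lemma mem_compositions n alpha : (alpha \in compositions n) = (weight alpha == n).
Proof.
apply/idP/eqP => [/imageP[T _ ->]|wE]; first exact: weight_compn.
by rewrite -(descentsK wE); apply: image_f.
Qed.

Lemma compositions_uniq n : uniq (compositions n).
Proof. by apply/injectiveP => T U E; rewrite -(compnK T) E compnK. Qed.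

Lemma comp_inv_cons a alpha : comp_inv (a :: alpha) = a * weight alpha + comp_inv alpha.
Proof.
rewrite /comp_inv /= big_ord_recl; congr (_ + _).
  rewrite big_mkcond big_ord_recl /= add0n big_distrr /= /weight.
  rewrite [RHS]big_tnth; apply: eq_bigr => i _.
  by rewrite !(tnth_nth a).
apply: eq_bigr => i _; rewrite big_mkcond big_ord_recl /= add0n [RHS]big_mkcond.
by apply: eq_bigr => j _; rewrite /bump /= !add1n ltnS !(tnth_nth a).
Qed.

(** Hence the subtraction of naturals in [qsym_Ft] below is never truncated. *)
Lemma leq_comp_inv_refines beta alpha : refines beta alpha -> comp_inv alpha <= comp_inv beta.
Proof.
have inv_cat b s : comp_inv (b ++ s) = comp_inv b + weight b * weight s + comp_inv s.
  elim: b => [|a b IH]; first by rewrite /comp_inv big_ord0 weight_nil.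
  by rewrite cat_cons !comp_inv_cons IH weight_cons weight_cat mulnDr mulnDl !addnA
     (addnAC (a * weight b) (comp_inv b)).
case/refinesP=> bs -> {beta}.
have W s t : [seq weight b | b <- s] = [seq nat_of_pos a | a <- t] ->
    weight (flatten s) = weight t.
  by elim: s t => [|b s IH] [|a t] //= [ba /IH E]; rewrite weight_cat weight_cons E ba.
elim: bs alpha => [|b bs IH] [|a alpha] //= [ba E].
rewrite inv_cat comp_inv_cons leq_add ?IH //.
by rewrite (W _ _ E) ba leq_addl.
Qed.

Local Open Scope ring_scope.

Section QSym.

Variable R : comNzRingType.

Local Notation A := {poly R}.
Local Notation q := ('X : A).

(** The ground ring is [R[q] = {poly R}].  [<<alpha>>] is the basis element
    [M_alpha], and [fglift] is extension by linearity from the basis. *)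
Definition QSym := {freeg composition / A}.
HB.instance Definition _ := GRing.Lmodule.on QSym.

(** [QSym (x) QSym] over [R[q]], as the free module on the pairs of basis
    elements: [<<(alpha, beta)>>] is [M_alpha (x) M_beta]. *)
Definition QSym2 := {freeg (composition * composition) / A}.
HB.instance Definition _ := GRing.Lmodule.on QSym2.

Definition qsym_M (alpha : composition) : QSym := << alpha >>.

Definition qsym_tensor (f g : QSym) : QSym2 :=
  fglift (fun alpha => fglift (fun beta => << (alpha, beta) >> : QSym2) g) f.

Definition qsym_tensor_map (S T : QSym -> QSym) : QSym2 -> QSym2 :=
  fglift (fun ab => qsym_tensor (S (qsym_M ab.1)) (T (qsym_M ab.2))).

Definition qsym_prepend (a : posnat) : QSym -> QSym :=
  fglift (fun gamma => qsym_M (a :: gamma)).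

(** The product of two basis elements.  As a power series over [R[q]] in
    variables with [x_j x_i = q x_i x_j] for [i < j], [M_alpha] is the sum of
    the [x_(i_1)^alpha_1 ... x_(i_l)^alpha_l] with [i_1 < ... < i_l].  The three
    terms collect the products of monomials whose smallest index comes from
    [alpha] only, from [beta] only, or from both; the powers of [q] come from
    moving [x_i^b] to the left past the variables of larger index. *)
Fixpoint qsym_mulM (alpha : composition) : composition -> QSym :=
  if alpha is a :: alpha' then
    fix mulMa (beta : composition) : QSym :=
      if beta is b :: beta' then
        qsym_prepend a (qsym_mulM alpha' beta)
        + q ^+ (b * (a + weight alpha')) *: qsym_prepend b (mulMa beta')
        + q ^+ (b * weight alpha') *:
            qsym_prepend (posnat_add a b) (qsym_mulM alpha' beta')
      else qsym_M alpha
  else qsym_M.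

Definition qsym_mul : QSym2 -> QSym := fglift (fun ab => qsym_mulM ab.1 ab.2).

Definition qsym_unit (c : A) : QSym := c *: qsym_M [::].

Definition qsym_comul : QSym -> QSym2 :=
  fglift (fun alpha =>
    \sum_(0 <= k < (size alpha).+1)
      qsym_tensor (qsym_M (take k alpha)) (qsym_M (drop k alpha))).

Definition qsym_counit : QSym -> A := fglift (fun alpha => (alpha == [::])%:R : A^o).

Definition is_antipode (S : {linear QSym -> QSym}) : Prop :=
  qsym_mul \o qsym_tensor_map S id \o qsym_comul =1 qsym_unit \o qsym_counit /\
  qsym_mul \o qsym_tensor_map id S \o qsym_comul =1 qsym_unit \o qsym_counit.

Definition qsym_F (alpha : composition) : QSym :=
  \sum_(beta <- compositions (weight alpha) | refines beta alpha) qsym_M beta.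

Definition qsym_Ft (alpha : composition) : QSym :=
  \sum_(beta <- compositions (weight alpha) | refines beta alpha)
    q ^+ (comp_inv beta - comp_inv alpha)%N *: qsym_M beta.

End QSym.

(* Main.v *)
From HB Require Import structures.
Require Import Defs.
From mathcomp Require Import all_boot all_algebra.
From mathcomp.multinomials Require Import freeg.

(** Writing [gamma >= alpha] when [alpha] refines [gamma], the antipode on the
    monomial basis is
      [S M_alpha = (-1)^(size alpha) sum_(gamma >= rev alpha) q^(inv gamma) M_gamma].
    Indeed, the left antipode equation determines [S M_alpha] by recursion on
    the length, and for this candidate the product of the [k]-th prefix term with
    [M_(drop k alpha)] is, up to the sign [(-1)^k], a sum [Y_k + Y_(k+1)]: the
    terms whose smallest index comes from the left factor only, and the others,
    which are those of the first kind for [k+1].  The alternating sum telescopes.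

    Encode the compositions of [n] by their descent sets, so that refinement is
    inclusion and [rev] is induced by [i |-> n - i].  The coefficient of [M_gamma]
    in [S F_alpha] is then [q^(inv gamma)] times a sum of signs over all sets
    containing [D(alpha)] and [n - D(gamma)].  It vanishes unless these two cover
    everything, which says exactly that [gamma] refines the transpose of [alpha]. *)

Set Implicit Arguments.
Unset Strict Implicit.
Unset Printing Implicit Defensive.

Import GRing.Theory.
Local Open Scope ring_scope.

(** * Linear extension from the basis of a free module *)

Section Fglift.

Variables (A : nzRingType) (K : choiceType) (M : lmodType A).

Lemma freegZ (c k : A) (x : K) : c *: << k *g x >> = << (c * k) *g x >>.
Proof. by apply/eqP/freeg_eqP => y; rewrite coeffZ !coeffU mulrA. Qed.

Lemma fglift_is_linear (f : K -> M) : linear (fglift f).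
Proof.
have fgB := lift_is_additive f.
have fg0 : fglift f 0 = 0 by rewrite -(subrr 0) fgB subrr.
have fgD : {morph fglift f : x y / x + y}.
  by move=> x y; rewrite -{1}[y]opprK fgB -[- y]sub0r fgB fg0 sub0r opprK.
move=> c u v; rewrite fgD; congr (_ + _).
rewrite -[u]freeg_sumE scaler_sumr !(big_morph _ fgD fg0) scaler_sumr.
by apply: eq_bigr => z _; rewrite freegZ !liftU scalerA.
Qed.

HB.instance Definition _ (f : K -> M) :=
  GRing.isLinear.Build A {freeg K / A} M *:%R (fglift f) (fglift_is_linear f).

Lemma fgliftU1 (f : K -> M) x : fglift f << x >> = f x.
Proof. by rewrite liftU scale1r. Qed.

Lemma freeg_linear_ext (f g : {linear {freeg K / A} -> M}) :
  (forall x, f << x >> = g << x >>) -> f =1 g.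
Proof.
move=> fg u; rewrite -[u]freeg_sumE !linear_sum; apply: eq_bigr => z _.
by rewrite -[coeff z u]mulr1 -freegZ !linearZ /= fg.
Qed.

End Fglift.

(** * Products with coarsening sums, and the antipode on the monomial basis *)

Section Product.

Variable R : comNzRingType.

Local Notation q := ('X : {poly R}).
Local Notation M := (@qsym_M R).
Local Notation mulM := (@qsym_mulM R).

HB.instance Definition _ (a : posnat) := GRing.Linear.on (@qsym_prepend R a).

Lemma qsym_linear_ext (f g : {linear QSym R -> QSym R}) :
  (forall gamma, f (M gamma) = g (M gamma)) -> f =1 g.
Proof. exact: freeg_linear_ext. Qed.

Lemma qsym_prependM a gamma : qsym_prepend a (M gamma) = M (a :: gamma).
Proof. exact: fgliftU1. Qed.

(** In the left antipode equation the right factors are basis elements, so the product is needed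
    only as a linear map in its left factor. *)
Definition qsym_mulr (s : composition) : QSym R -> QSym R :=
  fglift (fun gamma => mulM gamma s).

HB.instance Definition _ s := GRing.Linear.on (qsym_mulr s).

Lemma qsym_mulrM s gamma : qsym_mulr s (M gamma) = mulM gamma s.
Proof. exact: fgliftU1. Qed.

Lemma qsym_mul_tensorM s f : qsym_mul (qsym_tensor f (M s)) = qsym_mulr s f.
Proof.
rewrite /qsym_mul /qsym_tensor.
pose F := (fglift (fun ab => qsym_mulM R ab.1 ab.2) \o
  fglift (fun alpha => fglift (fun beta => << (alpha, beta) >> : QSym2 R) (M s))).
apply: (qsym_linear_ext (f := F) (g := qsym_mulr s)) => gamma.
by rewrite /F /= !(fgliftU1 (M := QSym2 R)) (fgliftU1 (M := QSym R)) qsym_mulrM.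
Qed.

Lemma qsym_mulM_cons a alpha b beta :
  mulM (a :: alpha) (b :: beta) =
  qsym_prepend a (mulM alpha (b :: beta))
  + q ^+ (b * (a + weight alpha)) *: qsym_prepend b (mulM (a :: alpha) beta)
  + q ^+ (b * weight alpha) *: qsym_prepend (posnat_add a b) (mulM alpha beta).
Proof. by []. Qed.

Lemma qsym_mulr0 : qsym_mulr [::] =1 id.
Proof.
apply: (qsym_linear_ext (f := qsym_mulr [::]) (g := idfun)) => gamma /=.
by rewrite qsym_mulrM; case: gamma.
Qed.

(** The powers of [q] in the product recursion depend on [gamma] only through its weight, so the
    recursion extends to homogeneous combinations. *)
Lemma qsym_mulr_prepend (L : seq composition) (k : composition -> {poly R})
    m b c s :
  (forall gamma, gamma \in L -> weight gamma = m) ->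
  let f := \sum_(gamma <- L) k gamma *: M gamma in
  qsym_mulr (c :: s) (qsym_prepend b f) =
  qsym_prepend b (qsym_mulr (c :: s) f)
  + q ^+ (c * (b + m)) *: qsym_prepend c (qsym_mulr s (qsym_prepend b f))
  + q ^+ (c * m) *: qsym_prepend (posnat_add b c) (qsym_mulr s f).
Proof.
move=> wL f; rewrite /f !linear_sum -!big_split /=.
apply: eq_big_seq => gamma /wL wg.
by rewrite !linearZ /= !qsym_prependM !qsym_mulrM qsym_mulM_cons wg !scalerDr.
Qed.

(** Lists the compositions refined by [b :: r]; [b] accumulates the parts merged so far into the
    first one. *)
Fixpoint coarsenings (b : posnat) (r : composition) : seq composition :=
  if r is a :: r' then
    [seq b :: gamma | gamma <- coarsenings a r'] ++ coarsenings (posnat_add b a) r'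
  else [:: [:: b]].

Lemma weight_coarsenings b r gamma :
  gamma \in coarsenings b r -> weight gamma = weight (b :: r).
Proof.
elim: r b gamma => [|a r IH] b gamma /=; first by rewrite inE => /eqP ->.
rewrite mem_cat => /orP[/mapP[g /IH wg ->]|/IH ->].
  by rewrite !weight_cons wg weight_cons.
by rewrite !weight_cons /= addnA.
Qed.

Definition coarse_sum (b : posnat) (r : composition) : QSym R :=
  \sum_(gamma <- coarsenings b r) q ^+ comp_inv gamma *: M gamma.

Lemma coarse_sum_nil b : coarse_sum b [::] = M [:: b].
Proof.
rewrite /coarse_sum /= big_seq1 comp_inv_cons weight_nil muln0 add0n.
by rewrite /comp_inv big_ord0 expr0 scale1r.
Qed.

Lemma coarse_sum_cons b a r :
  coarse_sum b (a :: r) =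
  q ^+ (b * weight (a :: r)) *: qsym_prepend b (coarse_sum a r)
  + coarse_sum (posnat_add b a) r.
Proof.
rewrite /coarse_sum /= big_cat big_map; congr (_ + _).
rewrite linear_sum scaler_sumr; apply: eq_big_seq => gamma /weight_coarsenings wg.
by rewrite linearZ /= qsym_prependM scalerA -exprD comp_inv_cons wg.
Qed.

(* The terms of [coarse_sum b r * M_s] whose smallest index comes from the left
   factor only. *)
Fixpoint left_terms (b : posnat) (r s : composition) : QSym R :=
  if r is a :: r' then
    q ^+ (b * weight r) *: qsym_prepend b (qsym_mulr s (coarse_sum a r'))
    + left_terms (posnat_add b a) r' s
  else qsym_prepend b (M s).

Lemma left_terms_cons b a r s :
  left_terms b (a :: r) s =
  q ^+ (b * weight (a :: r)) *: qsym_prepend b (qsym_mulr s (coarse_sum a r))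
  + left_terms (posnat_add b a) r s.
Proof. by []. Qed.

Lemma left_terms0 b r : left_terms b r [::] = coarse_sum b r.
Proof.
elim: r b => [|a r IH] b; first by rewrite coarse_sum_nil /= qsym_prependM.
by rewrite /= IH qsym_mulr0 coarse_sum_cons.
Qed.

Lemma posnat_addA : associative posnat_add.
Proof. by move=> a b c; apply: val_inj; rewrite /= addnA. Qed.

Lemma posnat_addC : commutative posnat_add.
Proof. by move=> a b; apply: val_inj; rewrite /= addnC. Qed.

(** A term not of the first kind begins with [c], alone or merged with an initial block of [b :: r].
    It thus comes from a coarsening of [c :: b :: r], and the power of [q] from moving [c] to the
    left completes the inversion number. *)
Lemma qsym_mulr_coarse_sum b r c s :
  qsym_mulr (c :: s) (coarse_sum b r) =
  left_terms b r (c :: s) + left_terms c (b :: r) s.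
Proof.
elim: r b => [|a r IH] b.
  rewrite coarse_sum_nil qsym_mulrM qsym_mulM_cons weight_nil muln0 expr0 scale1r.
  rewrite left_terms_cons coarse_sum_nil qsym_mulrM weight_cons weight_nil.
  by rewrite (posnat_addC b c) -addrA.
rewrite coarse_sum_cons linearD /= IH !left_terms_cons linearZ /=.
have wL := @weight_coarsenings a r.
rewrite [qsym_mulr (c :: s) (qsym_prepend b _)](qsym_mulr_prepend _ _ _ _ wL).
rewrite -/(coarse_sum a r) coarse_sum_cons !linearD !linearZ /=.
rewrite !scalerA -!exprD !weight_cons /=.
rewrite (posnat_addC b c) mulnDl -!addnA -(posnat_addA c b a).
rewrite [(b * _ + c * _)%N]addnC.
(* Terms 1 to 3 keep [b] as a separate part; terms 4 to 6 merge it with [a]. Each pair collects one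
   origin of the smallest index: left factor, right factor, both. *)
by rewrite [LHS](AC (3*(1*2)) ((1*4)*((2*5)*(3*6)))).
Qed.

Definition coarse_sum_seq (alpha : composition) : QSym R :=
  if alpha is b :: r then coarse_sum b r else M [::].

(** The empty case is 0 because the left factor is then 1, which contributes no index. *)
Definition left_terms_seq (alpha s : composition) : QSym R :=
  if alpha is b :: r then left_terms b r s else 0.

Lemma qsym_mulr_coarse_sum_seq r c s :
  qsym_mulr (c :: s) (coarse_sum_seq r) =
  left_terms_seq r (c :: s) + left_terms_seq (c :: r) s.
Proof.
case: r => [|b r] /=; first by rewrite add0r qsym_mulrM qsym_prependM.
exact: qsym_mulr_coarse_sum.
Qed.

Lemma sum_sign_telescope (A : nzRingType) (V : lmodType A) (Y : nat -> V) n :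
  \sum_(0 <= k < n) (-1) ^+ k *: (Y k + Y k.+1) = Y 0 - (-1) ^+ n *: Y n.
Proof.
elim: n => [|n IH]; first by rewrite big_geq // expr0 scale1r subrr.
by rewrite big_nat_recr //= IH exprS mulN1r scaleNr opprK scalerDr addrA subrK.
Qed.

HB.instance Definition _ := GRing.Linear.on (@qsym_mul R).
HB.instance Definition _ S T := GRing.Linear.on (@qsym_tensor_map R S T).

Lemma qsym_tensor_mapM S T alpha beta :
  qsym_tensor_map S T (qsym_tensor (M alpha) (M beta)) =
  qsym_tensor (S (M alpha)) (T (M beta)).
Proof.
by rewrite {1}/qsym_tensor !(fgliftU1 (M := QSym2 R)); exact: (fgliftU1 (M := QSym2 R)).
Qed.

Lemma antipode_qsym_M (S : {linear QSym R -> QSym R}) (hS : is_antipode S) alpha :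
  S (M alpha) = (-1) ^+ size alpha *: coarse_sum_seq (rev alpha).
Proof.
have [n] := ubnP (size alpha); elim: n alpha => // n IH alpha /ltnSE-lt_n.
have := hS.1 (M alpha).
rewrite /= [qsym_comul _]fgliftU1 [qsym_counit _]fgliftU1 !linear_sum /=.
under eq_bigr do rewrite qsym_tensor_mapM qsym_mul_tensorM.
(* The last summand, [k = size alpha], is [S (M alpha)] itself; the others involve proper prefixes
   only. *)
rewrite big_nat_recr //= take_size drop_size qsym_mulr0.
case: alpha lt_n => [|a alpha'] lt_n.
  by rewrite big_geq // add0r => ->; rewrite expr0 /qsym_unit !scale1r.
set alpha := a :: alpha' in lt_n *; rewrite [qsym_unit _]scale0r.
pose Y k := left_terms_seq (rev (take k alpha)) (drop k alpha).
have -> : \sum_(0 <= k < size alpha)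
    qsym_mulr (drop k alpha) (S (M (take k alpha))) =
    \sum_(0 <= k < size alpha) (-1) ^+ k *: (Y k + Y k.+1).
  apply: eq_big_nat => k lt_k0; have {lt_k0} lt_k : (k < size alpha)%N by [].
  rewrite IH; last by rewrite size_take lt_k; exact: leq_trans lt_k lt_n.
  rewrite linearZ /= size_take lt_k /Y (take_nth a lt_k) rev_rcons (drop_nth a lt_k).
  by rewrite qsym_mulr_coarse_sum_seq.
(* [Y 0] is 0, and [Y (size alpha)] is the whole coarsening sum because its right factor is 1. *)
rewrite sum_sign_telescope /Y take0 sub0r take_size drop_size => /eqP.
rewrite addrC subr_eq0 => /eqP ->; congr (_ *: _).
by rewrite /alpha rev_cons; case: (rev alpha') => [|b r]; exact: left_terms0.
Qed.

End Product.

(** * Refinement, by recursion on both lists and then through descent sets *)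

Section Refinement.

Local Open Scope nat_scope.

Lemma posnat_eq0 (a : posnat) : (a == 0 :> nat) = false.
Proof. by rewrite eqn0Ngt posnat_gt0. Qed.

Lemma posnat_eq_addr (a b : posnat) : (posnat_add a b == a) = false.
Proof. by rewrite -val_eqE /= -[X in _ == X]addn0 eqn_add2l posnat_eq0. Qed.

Lemma posnat_lt_addr (a b : posnat) : a < a + b.
Proof. by rewrite -[X in X < _]addn0 ltn_add2l posnat_gt0. Qed.

(** A positive part [a] is not the weight of an empty block, so [k = 0] drops out and [b] always
    enters the first block. *)
Lemma refines_consE b beta a alpha :
  refines (b :: beta) (a :: alpha) =
  has (fun k => (b + weight (take k beta) == a) && refines (drop k beta) alpha)
      (iota 0 (size beta).+1).
Proof.
have -> : refines (b :: beta) (a :: alpha) =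
    has (fun k => (weight (take k (b :: beta)) == a) && refines (drop k (b :: beta)) alpha)
        (0 :: [seq 1 + k | k <- iota 0 (size beta).+1]).
  by rewrite -(iotaDl 1 0).
move: (iota 0 _) => ks.
rewrite [LHS]/= weight_nil eq_sym posnat_eq0 has_map.
by apply: eq_has => k /=; rewrite weight_cons.
Qed.

Lemma refines_cons_lt (b a : posnat) beta alpha :
  a < b -> refines (b :: beta) (a :: alpha) = false.
Proof.
move=> ab; rewrite refines_consE; apply/hasP => -[k _ /andP[/eqP E _]].
by move: ab; rewrite -E ltnNge leq_addr.
Qed.

Lemma refines_cons_add b beta d alpha :
  refines (b :: beta) (posnat_add b d :: alpha) = refines beta (d :: alpha).
Proof. by rewrite refines_consE; apply: eq_has => k /=; rewrite eqn_add2l. Qed.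

Lemma weight_eq0 alpha : (weight alpha == 0) = (alpha == [::]).
Proof.
case: alpha => [|a alpha]; first by rewrite weight_nil.
by rewrite weight_cons addn_eq0 posnat_eq0.
Qed.

Lemma refines_cons_eq b beta alpha : refines (b :: beta) (b :: alpha) = refines beta alpha.
Proof.
rewrite refines_consE; apply/hasP/idP => [[k _]|ref].
  rewrite -[X in _ == X]addn0 eqn_add2l weight_eq0 => /andP[/eqP tk].
  by rewrite -{2}[beta](cat_take_drop k) tk.
by exists 0; rewrite ?mem_iota // take0 drop0 weight_nil addn0 eqxx.
Qed.

Lemma refines_nil alpha : refines [::] alpha = (alpha == [::]).
Proof. by case: alpha => [|a alpha] //=; rewrite weight_nil eq_sym posnat_eq0. Qed.

(** The difference [d] is itself a positive part, so the case of a larger [a] has the shape required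
    by [refines_cons_add]. *)
Variant posnat_compare (a b : posnat) : Prop :=
  | PosnatLt of a < b
  | PosnatEq of a = b
  | PosnatAdd d of a = posnat_add b d.

Lemma posnat_compareP a b : posnat_compare a b.
Proof.
case: (ltngtP a b) => [ab|ba|/val_inj ab]; first exact: PosnatLt.
  apply: (@PosnatAdd _ _ (@PosNat (a - b) _)); first by rewrite subn_gt0.
  by move=> d_gt0; apply: val_inj; rewrite /= subnKC // ltnW.
exact: PosnatEq.
Qed.

Lemma mem_coarsenings b r gamma : (gamma \in coarsenings b r) = refines (b :: r) gamma.
Proof.
elim: r b gamma => [|a r IH] b [|c gamma] //.
- rewrite [coarsenings _ _]/= inE eqseq_cons; case: (posnat_compareP c b) => [cb|->|d ->].
  + by rewrite refines_cons_lt // -val_eqE ltn_eqF.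
  + by rewrite eqxx refines_cons_eq refines_nil.
  + by rewrite refines_cons_add refines_nil posnat_eq_addr.
- rewrite [coarsenings _ _]/= mem_cat IH orbF; apply/mapP => -[g _ //].
have mem_map_cons (c' : posnat) g s :
    (c' :: g \in [seq b :: g' | g' <- s]) = (c' == b) && (g \in s).
  apply/mapP/andP => [[g' sg' [-> ->]]|[/eqP -> gs]]; last by exists g.
  by rewrite eqxx.
rewrite [coarsenings _ _]/= mem_cat mem_map_cons !IH.
case: (posnat_compareP c b) => [cb|->|d ->].
- by rewrite -val_eqE ltn_eqF // !refines_cons_lt // (leq_trans cb) // leq_addr.
- rewrite eqxx refines_cons_eq (@refines_cons_lt (posnat_add b a) b) ?orbF //.
  exact: posnat_lt_addr.
(* Only the second list can contain a composition with head [b + d]; there the common summand [b]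
   cancels, as comparing [d] with [a] shows. *)
rewrite posnat_eq_addr refines_cons_add.
case: (posnat_compareP d a) => [da|->|e ->].
- by rewrite !refines_cons_lt // ltn_add2l.
- by rewrite !refines_cons_eq.
- by rewrite posnat_addA !refines_cons_add.
Qed.

Lemma coarsenings_uniq b r : uniq (coarsenings b r).
Proof.
elim: r b => [//|a r IH] b /=; rewrite cat_uniq IH andbT map_inj_uniq ?IH /=.
  2: by move=> ? ? [].
apply/hasP => -[gamma rg /mapP[g _ E]]; move: rg.
by rewrite E mem_coarsenings refines_cons_lt //; apply: posnat_lt_addr.
Qed.

Lemma mem_scanl_weight x alpha t :
  reflect (exists2 k, k < size alpha & x + weight (take k.+1 alpha) = t)
    (t \in scanl addn x [seq Defs.nat_of_pos a | a <- alpha]).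
Proof.
elim: alpha x => [|a alpha IH] x /=; first by apply: (iffP idP) => // -[].
rewrite inE; apply: (iffP orP) => [[/eqP ->|/IH [k lk <-]]|[[|k] lk wk]].
- by exists 0; rewrite // take0 weight_cons weight_nil addn0.
- by exists k.+1; rewrite // weight_cons addnA.
- by left; rewrite -wk take0 weight_cons weight_nil addn0.
- by right; apply/IH; exists k; rewrite // -wk /= weight_cons addnA.
Qed.

Lemma descentsP n alpha (i : 'I_n.-1) :
  reflect (exists k, weight (take k alpha) = i.+1) (i \in descents n alpha).
Proof.
rewrite inE; apply: (iffP (mem_scanl_weight _ _ _)) => [[k _ <-]|[k wk]].
  by exists k.+1.
have [lek|gtk] := leqP k (size alpha).
  case: k => [|k] in wk lek *; first by rewrite take0 weight_nil in wk.
  by exists k.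
rewrite take_oversize ?(ltnW gtk) // in wk.
case: alpha wk {gtk} => [|a s]; first by rewrite weight_nil.
by exists (size s); rewrite //= take_size.
Qed.

Lemma weight_take_le k alpha : weight (take k alpha) <= weight alpha.
Proof. by rewrite -{2}[alpha](cat_take_drop k) weight_cat leq_addr. Qed.

(** A refinement cuts [beta] at partial sums equal to those of [alpha]. As [take] saturates, the
    indices need no bounds. *)
Lemma refines_partial_sums beta alpha :
  weight beta = weight alpha ->
  reflect (forall i, exists j, weight (take j beta) = weight (take i alpha))
    (refines beta alpha).
Proof.
elim: alpha beta => [|a alpha IH] beta.
  rewrite weight_nil => /eqP; rewrite weight_eq0 => /eqP ->.
  by apply: (iffP idP) => // _ i; exists 0; rewrite weight_nil.
rewrite weight_cons => wb.
apply: (iffP hasP) => [[k _ /andP[/eqP wk]]|sums].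
  have wd : weight (drop k beta) = weight alpha.
    by apply/eqP; rewrite -(eqn_add2l a) -wb -{1}wk -weight_cat cat_take_drop.
  move/(IH _ wd) => sums [|i]; first by exists 0; rewrite !take0.
  case: (sums i) => j wj; exists (k + j).
  by rewrite takeD weight_cat wk wj /= weight_cons.
have [k wk] := sums 1; rewrite /= take0 weight_cons weight_nil addn0 in wk.
(* [refines] searches only [k] up to [size beta]; a larger [k] takes the same prefix. *)
wlog lek : k wk / k <= size beta => [H|].
  have [/H|/ltnW gtk] := leqP k (size beta); first exact.
  by apply: (H (size beta)); rewrite // take_size -(take_oversize gtk).
exists k; first by rewrite mem_iota add0n ltnS lek.
have wd : weight (drop k beta) = weight alpha.
  by apply/eqP; rewrite -(eqn_add2l a) -wb -{1}wk -weight_cat cat_take_drop.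
rewrite wk eqxx /=; apply/(IH _ wd) => i.
have [j] := sums i.+1; rewrite /= weight_cons => wj.
exists (j - k); have [kj|/ltnW jk] := leqP k j.
  by apply/eqP; rewrite -(eqn_add2l a) -wj -{1}wk -weight_cat -takeD subnKC.
(* Here the prefix of length [j] lies inside the first block, of weight [a], so [take i alpha] has
   weight 0 and the truncated [j - k = 0] serves. *)
have := weight_take_le j (take k beta); rewrite take_takel // wj wk.
rewrite -[X in _ <= X]addn0 leq_add2l leqn0 => /eqP ->.
by have := jk; rewrite -subn_eq0 => /eqP ->; rewrite take0 weight_nil.
Qed.

(** The partial sums 0 and [n] are common to both compositions, so only those strictly between them
    matter. *)
Lemma refines_descents n beta alpha :
  weight beta = n -> weight alpha = n ->
  refines beta alpha = (descents n alpha \subset descents n beta).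
Proof.
move=> wb wa; have wba : weight beta = weight alpha by rewrite wb wa.
apply/(refines_partial_sums wba)/subsetP => [sums i /descentsP[k wk]|sub i].
  by apply/descentsP; case: (sums k) => j wj; exists j; rewrite wj.
have := weight_take_le i alpha; rewrite wa leq_eqVlt => /orP[/eqP ->|lt_n].
  by exists (size beta); rewrite take_size wb.
case: (posnP (weight (take i alpha))) => [->|gt0].
  by exists 0; rewrite take0 weight_nil.
have lt : (weight (take i alpha)).-1 < n.-1 by rewrite ltn_predRL prednK.
have /sub/descentsP[j wj] : Ordinal lt \in descents n alpha.
  by apply/descentsP; exists i; rewrite /= prednK.
by exists j; rewrite wj /= prednK.
Qed.

Lemma refines_compn n (U T : {set 'I_n.-1}) :
  refines (compn U) (compn T) = (T \subset U).
Proof. by rewrite (refines_descents (n := n)) ?weight_compn // !compnK. Qed.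

Lemma weight_rev alpha : weight (rev alpha) = weight alpha.
Proof. by rewrite /weight big_rev. Qed.

(** What follows the partial sum [i.+1] has weight [n - i.+1 = (rev_ord i).+1], and its reversal is
    a prefix of [rev beta]. *)
Lemma descents_rev_mem n beta (i : 'I_n.-1) :
  weight beta = n -> i \in descents n beta -> rev_ord i \in descents n (rev beta).
Proof.
move=> wb /descentsP[k wk]; apply/descentsP; exists (size beta - k).
rewrite take_rev weight_rev.
have -> : drop (size beta - (size beta - k)) beta = drop k beta.
  by rewrite -minnE; case: leqP => // sk; rewrite drop_size drop_oversize.
have := congr1 weight (cat_take_drop k beta); rewrite weight_cat wb wk => wd.
by rewrite -(addKn i.+1 (weight _)) wd /= subnS subnSK ?ltn_ord // -subn1 subnAC subn1.
Qed.

Lemma descents_rev n beta :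
  weight beta = n -> descents n (rev beta) = [set rev_ord i | i in descents n beta].
Proof.
move=> wb; apply/setP => i; apply/idP/imsetP => [|[j jb ->]]; last first.
  exact: descents_rev_mem.
move/(descents_rev_mem _); rewrite weight_rev revK => /(_ wb) ib.
by exists (rev_ord i); rewrite ?rev_ordK.
Qed.

Lemma rev_ord_subset m (G U : {set 'I_m}) :
  (G \subset [set rev_ord i | i in U]) = ([set rev_ord i | i in G] \subset U).
Proof.
apply/subsetP/subsetP => [sub _ /imsetP[i /sub /imsetP[j jU ->] ->]|sub i iG].
  by rewrite rev_ordK.
by apply/imsetP; exists (rev_ord i); rewrite ?rev_ordK // sub // imset_f.
Qed.

Lemma refines_rev_compn n (U G : {set 'I_n.-1}) :
  refines (rev (compn U)) (compn G) = ([set rev_ord i | i in G] \subset U).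
Proof.
rewrite (refines_descents (n := n)) ?weight_rev ?weight_compn //.
by rewrite descents_rev ?weight_compn // !compnK rev_ord_subset.
Qed.

Lemma size_compn n (U : {set 'I_n.-1}) : 0 < n -> size (compn U) = #|U|.+1.
Proof.
move=> n_gt0; rewrite -(size_map Defs.nat_of_pos) compn_parts // size_pairmap.
by rewrite size_rcons size_map -cardE.
Qed.

End Refinement.

(** * Signed sums over descent sets *)

Lemma sum_sign_supsets (A : comNzRingType) (I : finType) (V : {set I}) :
  \sum_(U : {set I} | V \subset U) (-1) ^+ #|~: U| = (V == setT)%:R :> A.
Proof.
(* Expand a product of factors 1 + 0 on [V] and 1 - 1 off [V], with [U] the set where the first
   summand is chosen. Any element off [V] makes the product vanish. *)
have := @bigA_distr A 0 1 *%R +%R I (fun=> 1) (fun i => if i \in V then 0 else -1).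
have -> : \prod_(i : I) (1 + (if i \in V then 0 else -1)) = (V == setT)%:R :> A.
  have [->|VT] := eqVneq V setT; first by rewrite big1 // => i _; rewrite inE addr0.
  have /subsetPn[i _ iV] : ~~ (setT \subset V) by rewrite subTset.
  by rewrite (bigD1 i) //= (negPf iV) subrr mul0r.
move=> ->; rewrite big_mkcond /=; apply: eq_bigr => U _.
case: ifP => [VU|/negbT/subsetPn[i iV iU]]; last first.
  by rewrite (bigD1 i) //= (negPf iU) iV mul0r.
rewrite -prodr_const [LHS]big_mkcond; apply: eq_bigr => i _; rewrite inE.
by case: (boolP (i \in U)) => //= iU; case: ifP => // iV; rewrite (subsetP VU i iV) in iU.
Qed.

Lemma big_compositions (M : nmodType) n (P : pred composition) (F : composition -> M) :
  \sum_(beta <- compositions n | P beta) F beta =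
  \sum_(U : {set 'I_n.-1} | P (compn U)) F (compn U).
Proof. by rewrite /compositions big_image_cond. Qed.

(** For positive [n] the length is [#|U| + 1] and [#|U| + #|~: U| = n - 1], so the length and
    [n + #|~: U|] have the same parity. For [n = 0] both the composition and the complement are
    empty. *)
Lemma sign_size_compn (A : nzRingType) n (U : {set 'I_n.-1}) :
  (-1) ^+ size (compn U) = (-1) ^+ n * (-1) ^+ #|~: U| :> A.
Proof.
case: (posnP n) => [n0|n_gt0].
  have := weight_compn U; rewrite {2}n0 => /eqP; rewrite weight_eq0 => /eqP ->.
  have -> : #|~: U| = 0%N by apply/eqP; rewrite -leqn0 (leq_trans (max_card _)) // card_ord n0.
  by rewrite n0 mulr1.
have -> : (-1) ^+ n = (-1) ^+ (#|U| + #|~: U|).+1 :> A.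
  by rewrite cardsC card_ord prednK.
rewrite size_compn // !exprS exprD -!mulrA -expr2 -exprM mulnC.
by rewrite exprM sqrrN !expr1n mulr1.
Qed.

Lemma refines_weight beta alpha : refines beta alpha -> weight beta = weight alpha.
Proof.
case: beta => [|b beta]; first by rewrite refines_nil => /eqP ->.
by rewrite -mem_coarsenings => /weight_coarsenings.
Qed.

(** * The antipode on the fundamental basis *)

Section Antipode.

Variable R : comNzRingType.

Local Notation q := ('X : {poly R}).
Local Notation M := (@qsym_M R).

Lemma coarse_sum_seqE n alpha : weight alpha = n ->
  coarse_sum_seq R alpha =
  \sum_(gamma <- compositions n | refines alpha gamma) q ^+ comp_inv gamma *: M gamma.
Proof.
move=> wa.
have sum_over L : uniq L -> L =i (fun gamma => refines alpha gamma) ->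
    \sum_(gamma <- L) q ^+ comp_inv gamma *: M gamma =
    \sum_(gamma <- compositions n | refines alpha gamma) q ^+ comp_inv gamma *: M gamma.
  move=> uL memL; rewrite -[RHS]big_filter; apply: perm_big; apply: uniq_perm => //.
    exact/filter_uniq/compositions_uniq.
  move=> gamma; rewrite mem_filter mem_compositions memL andb_idr // => /refines_weight <-.
  by rewrite wa.
case: alpha wa sum_over => [|b r] wa sum_over /=.
  rewrite -(sum_over [:: [::]]) ?big_seq1 //; last by move=> gamma; rewrite inE -refines_nil.
  by rewrite /comp_inv big_ord0 expr0 scale1r.
exact: (sum_over _ (coarsenings_uniq b r) (mem_coarsenings b r)).
Qed.

End Antipode.

Theorem theorem3p27 (R : comNzRingType) (S : {linear QSym R -> QSym R})
    (hS : is_antipode S) (n : nat) (alpha : composition)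
    (halpha : weight alpha = n) :
  S (qsym_F R alpha) =
  ((-1) ^+ n * 'X^(comp_inv (tr_comp alpha))) *: qsym_Ft R (tr_comp alpha).
Proof.
rewrite -(descentsK halpha); move: (descents _ _) => T {alpha halpha}.
rewrite tr_comp_compn; set T' := [set rev_ord i | i in ~: T].
rewrite /qsym_F /qsym_Ft !weight_compn linear_sum.
under eq_bigr => beta _.
  rewrite (antipode_qsym_M hS).
  over.
rewrite big_compositions.
under eq_bigr => U _.
  rewrite (@coarse_sum_seqE R n) ?weight_rev ?weight_compn //.
  rewrite big_compositions.
  under eq_bigl do rewrite refines_rev_compn.
  rewrite scaler_sumr.
  over.
(* With [G] fixed, the inner sum runs over the [U] containing both [T] and the reversal of [G], and
   only signs vary with [U]. *)
rewrite (exchange_big_dep xpredT) //=.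
rewrite scaler_sumr big_compositions [RHS]big_mkcond /=.
apply: eq_bigr => G _.
rewrite -scaler_suml.
under eq_bigl do rewrite refines_compn -subUset.
under eq_bigr do rewrite sign_size_compn.
rewrite -mulr_sumr sum_sign_supsets.
(* The union is everything iff the reversal of [G] contains the complement of [T], that is, iff [G]
   contains [T']. *)
have -> : (T :|: [set rev_ord i | i in G] == setT) = refines (compn G) (compn T').
  by rewrite refines_compn -rev_ord_subset -setTD subDset -subTset.
case: ifP => [refG|_]; last by rewrite mulr0 scale0r.
(* Since [compn G] refines [compn T'], the difference of inversion numbers is not truncated, and the
   powers of [q] recombine. *)
rewrite mulr1 !scalerA -mulrA -exprD subnKC //.
exact: leq_comp_inv_refines.
Qed.
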